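(* Let $c_n(t)$ denote the value at $q=-1$ of the $q$-Narayana polynomial $C_n(t;q)$. The generating function $$g(t,z)=\sum_{n\ge 0}c_{n+1}(t)z^n$$ has the continued fraction expansion of Jacobi type $$g(t,z)=\cfrac{1}{1-s_0z-\cfrac{t_0z^2}{1-s_1z-\cfrac{t_1z^2}{1-\ddots}}}$$ with $s_n=(-1)^n(1+t)$ and $t_n=-t$ for all $n\ge 0$. Moreover, for all $n\ge 0$, $$c_{2n+1}(t)=\sum_{k=0}^{n}(-t)^k\binom{n}{k}C_k(1+t)^{2n-2k},$$ $$c_{2n+2}(t)=\sum_{k=0}^{n}(-t)^k\binom{n}{k}C_k(1+t)^{2n-2k+1},$$ where $C_k=\frac{1}{k+1}\binom{2k}{k}$ is the $k$-th Catalan number.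
   Context: Notation: $[n]=[n]_q=\sum_{j=0}^{n-1}q^j$, $[n]!=\prod_{j=1}^n[j]$, and $\begin{bmatrix}n\\k\end{bmatrix}=\frac{[n]!}{[k]!\,[n-k]!}$ for $0\le k\le n$ (and $0$ otherwise). For $n\ge 1$ the $q$-Narayana polynomials are $$C_n(t;q)=\sum_{k=0}^{n-1}q^{k^2+k}\begin{bmatrix}n\\k\end{bmatrix}\begin{bmatrix}n-1\\k\end{bmatrix}\frac{t^k}{[k+1]},$$ and $c_n(t)=\lim_{q\to-1}C_n(t;q)$ (coefficientwise in $t$). For example, $c_1(t)=1$, $c_2(t)=1+t$, $c_3(t)=1+t+t^2$, $c_4(t)=1+2t+2t^2+t^3$. Generating functions are formal power series in $z$ with coefficients in $\mathbb{Z}[t]$. The continued fraction is understood as a formal power series in $z$ (the $z$-adic limit of its finite truncations). Here $t$ is the polynomial variable, while $t_0,t_1,\dots$ (with indices) are the continued fraction coefficients. *)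

(* Defs.v *)
From mathcomp Require Import all_boot all_order all_algebra.
From mathcomp Require Import zify ring.
From mathcomp Require Import all_classical all_reals all_analysis.

Set Implicit Arguments.
Unset Strict Implicit.
Unset Printing Implicit Defensive.

Import Order.TTheory GRing.Theory Num.Theory.
Import numFieldNormedType.Exports.

Local Open Scope classical_set_scope.
Local Open Scope ring_scope.

Section QAnalogues.
Variable R : realType.
Implicit Types (q : R) (n k : nat).

Definition qint q n : R := \sum_(j < n) q ^+ j.

Definition qfact q n : R := \prod_(1 <= j < n.+1) qint q j.

Definition qbinom q n k : R :=
  if (k <= n)%N then qfact q n / (qfact q k * qfact q (n - k)) else 0.

Definition qNarayana n q : {poly R} :=
  \poly_(k < n) (q ^+ (k ^ 2 + k) * qbinom q n k * qbinom q n.-1 k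
                 / qint q k.+1).

(* The variable 'X of {poly R} plays the role of t.  The right-hand side of
   qNarayana n q is not meaningful at q = -1 itself (there x / 0 = 0), hence
   the limit over the punctured neighbourhoods of -1; it exists by
   qNarayana_cvg below. *)
Definition cpoly n : {poly R} :=
  \poly_(k < n) lim ((qNarayana n q)`_k @[q --> (-1 : R)^']).

Definition catalan k : R := 'C(k.*2, k)%:R / k.+1%:R.

Lemma qint_val n : (0 < n)%N -> exists2 P : {poly R}, P.[-1] != 0 &
  forall q, qint q n = (1 + q) ^+ (~~ odd n) * P.[q].
Proof.
move=> n0; case: (boolP (odd n)) => on /=.
- exists (\sum_(j < n) 'X^j).
    rewrite horner_sum (eq_bigr (fun j : 'I_n => (-1) ^+ j)); last first.
      by move=> j _; rewrite hornerXn.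
    have -> : n = (n./2.*2).+1 by rewrite -[LHS]odd_double_half on.
    rewrite [X in X != 0](_ : _ = 1) ?oner_neq0//.
    elim: n./2 => [|m IH]; first by rewrite big_ord_recr big_ord0 /= add0r.
    rewrite doubleS 2!big_ord_recr /= IH !exprS -mul2n exprM sqrrN expr1n.
    by rewrite expr1n mulr1 mulrNN mulr1 addrNK.
  move=> q; rewrite expr0 mul1r /qint horner_sum.
  by apply: eq_bigr => j _; rewrite hornerXn.
- exists (\sum_(j < n./2) 'X^(j.*2)).
    rewrite horner_sum (eq_bigr (fun j : 'I_n./2 => 1)); last first.
      by move=> j _; rewrite hornerXn -signr_odd odd_double.
    rewrite sumr_const card_ord pnatr_eq0 -lt0n.
    by case: n n0 on => [|[|]].
  move=> q; rewrite expr1 /qint horner_sum.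
  have -> : n = n./2.*2 by rewrite -[LHS]odd_double_half (negbTE on).
  rewrite doubleK; elim: n./2 => [|m IH]; first by rewrite !big_ord0 mulr0.
  rewrite doubleS 2!big_ord_recr [in RHS]big_ord_recr /= IH hornerXn exprS.
  by ring.
Qed.

Lemma qfact_val n : exists2 P : {poly R}, P.[-1] != 0 &
  forall q, qfact q n = (1 + q) ^+ n./2 * P.[q].
Proof.
elim: n => [|n [P P0 HP]].
  exists 1; first by rewrite hornerE oner_neq0.
  by move=> q; rewrite /qfact big_geq // expr0 mul1r hornerE.
have [Q Q0 HQ] := qint_val (ltn0Sn n).
exists (P * Q); first by rewrite hornerM mulf_neq0.
move=> q; rewrite /qfact big_nat_recr //= -/(qfact q n) HP HQ hornerM /= negbK.
have -> : (uphalf n = n./2 + odd n)%N by rewrite uphalf_half addnC.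
by rewrite exprD; ring.
Qed.

Lemma qNarayana_cvg n k : cvg ((qNarayana n q)`_k @[q --> (-1 : R)^']).
Proof.
have [kn|kn] := ltnP k n; last first.
  have -> : (fun q => (qNarayana n q)`_k) = cst 0.
    by apply/funext => q; rewrite coef_poly ltnNge kn.
  exact: is_cvg_cst.
have [A A0 HA] := qfact_val n.
have [B B0 HB] := qfact_val n.-1.
have [C C0 HC] := qfact_val k.
have [D D0 HD] := qfact_val (n - k).
have [E E0 HE] := qfact_val (n.-1 - k).
have [F F0 HF] := qint_val (ltn0Sn k).
pose U := 'X^(k ^ 2 + k) * A * B; pose V := C * D * C * E * F.
have V0 : V.[-1] != 0 by rewrite !hornerM !mulf_neq0.
apply/cvg_ex; exists (U.[-1] / V.[-1]).
have UV : (fun q => U.[q] / V.[q]) @ (-1 : R)^' --> U.[-1] / V.[-1].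
  apply: cvgM; last apply: cvgV => //.
    by apply: cvg_within_filter; exact: continuous_horner.
  by apply: cvg_within_filter; exact: continuous_horner.
apply: cvg_trans UV; apply: near_eq_cvg.
near=> q.
have q1 : 1 + q != 0.
  rewrite addrC addr_eq0; near: q; exact: nbhs_dnbhs_neq.
rewrite coef_poly kn /qbinom (ltnW kn).
have kn1 : (k <= n.-1)%N by case: n kn {HA HB HD HE}.
rewrite kn1 HA HB HC HD HE HF !hornerM hornerXn.
have e : (n./2 + n.-1./2 = k./2 + k./2 + (n - k)./2 + (n.-1 - k)./2
                           + ~~ odd k.+1)%N by lia.
have {e} := congr1 (GRing.exp (1 + q)) e; rewrite !exprD.
have : forall m, (1 + q) ^+ m != 0 by move=> m; rewrite expf_neq0.
move: (GRing.exp (1 + q)) => x x0 e.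
have {e} : x n./2 * x n.-1./2 * (x k./2)^-1 * (x k./2)^-1 * (x (n - k)./2)^-1
    * (x (n.-1 - k)./2)^-1 * (x (~~ odd k.+1))^-1 = 1.
  by rewrite e; field; rewrite !x0.
move=> e; rewrite !invfM -[LHS]mulr1 -e; ring.
Unshelve. all: by end_near.
Qed.

End QAnalogues.

Section JacobiFractions.
Variable A : comUnitRingType.

(* Formal power series in z over A, as coefficient sequences. *)
Definition fps := nat -> A.
Implicit Types (f g h : fps) (s t : nat -> A).

Definition fps_mul f g : fps := fun n => \sum_(j < n.+1) f (n - j)%N * g j.

Fixpoint fps_inv_seq f n : seq A :=
  if n is m.+1 then
    let r := fps_inv_seq f m in
    rcons r ((f 0)^-1 * ((m == 0)%:R - \sum_(j < m) f (m - j)%N * r`_j))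
  else [::].

(* Multiplicative inverse, meaningful when the constant term is a unit:
   see fps_mulV. *)
Definition fps_inv f : fps := fun n => (fps_inv_seq f n.+1)`_n.

(* 1 - a z - b z^2 h(z) *)
Definition jden (a b : A) h : fps := fun n =>
  match n with 0 => 1 | 1 => - a | m.+2 => - (b * h m) end.

(* The truncation with N levels:
   1 / (1 - s_0 z - t_0 z^2 / ( ... / (1 - s_(N-1) z))), and 0 for N = 0. *)
Fixpoint jfrac_trunc s t N : fps :=
  if N is M.+1 then
    fps_inv (jden (s 0) (t 0)
               (jfrac_trunc (fun i => s i.+1) (fun i => t i.+1) M))
  else fun=> 0.

(* z-adic convergence *)
Definition fps_cvg (u : nat -> fps) g :=
  forall n, exists N0, forall N, (N0 <= N)%N -> u N n = g n.

Definition has_jfrac g s t := fps_cvg (jfrac_trunc s t) g.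

Lemma size_fps_inv_seq f n : size (fps_inv_seq f n) = n.
Proof. by elim: n => //= n IH; rewrite size_rcons IH. Qed.

Lemma nth_fps_inv_seq f n j : (j < n)%N -> (fps_inv_seq f n)`_j = fps_inv f j.
Proof.
elim: n => //= n IH; rewrite ltnS leq_eqVlt => /predU1P[->//|jn].
by rewrite nth_rcons size_fps_inv_seq jn IH.
Qed.

Lemma fps_mulV f : f 0 \is a GRing.unit ->
  fps_mul f (fps_inv f) = fun n => (n == 0)%:R.
Proof.
move=> f0; apply/funext => n; rewrite /fps_mul big_ord_recr /= subnn.
rewrite {2}/fps_inv /= nth_rcons size_fps_inv_seq ltnn eqxx mulVKr//.
under [X in _ - X]eq_bigr => j _ do rewrite nth_fps_inv_seq//.
by rewrite addrC subrK.
Qed.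

End JacobiFractions.

(* Main.v *)
(* At q = -1 the coefficient of t^k in C_n is
   'C(n/2, ceil(k/2)) 'C((n-1)/2, floor(k/2)), since each [2m] contributes
   1 + q times a factor tending to m.  By Pascal's rule
   c_(2n+2) = (1 + t) c_(2n+1), and the formula for c_(2n+1) follows by
   comparing coefficients of Y^n and Y^(n+1) in the two sides of
   ((1 + t)^2 Y - t (1 + Y)^2)^n = (1 - t Y)^n (Y - t)^n.
   For the continued fraction, write Cat for the Catalan series and
   u = - t w / (1 - (1 + t)^2 w), w = z^2.  The series
   f_0 = 1, f_(2j+1) = (1 + (1 + t) z) Cat(u)^(2j+1) / (1 - (1 + t)^2 w)^(j+1),
   f_(2j+2) = Cat(u)^(2j+2) / (1 - (1 + t)^2 w)^(j+1) satisfy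
   f_k = (1 - s_k z) f_(k+1) - t_k z^2 f_(k+2) because
   Cat^(r+1) = Cat^r + u Cat^(r+2); such a recurrence forces f_1 / f_0 = f_1 to
   be the continued fraction. *)
Require Import Defs.
From mathcomp Require Import all_boot all_order all_algebra.
From mathcomp Require Import zify ring.
From mathcomp Require Import all_classical all_reals all_analysis.

Import GRing.Theory.
Local Open Scope ring_scope.

(** * Products of power series and a recurrence that determines a Jacobi fraction *)

Section PowerSeries.
Variable A : comUnitRingType.
Implicit Types f g h : fps A.

(** Transfers commutativity and associativity from [{poly A}] to series. *)
Lemma fps_mulE f g n K : (n < K)%N ->
  fps_mul f g n = (\poly_(i < K) f i * \poly_(i < K) g i)`_n.
Proof.
move=> nK; rewrite coefMr; apply: eq_bigr => j _.
rewrite !coef_poly (leq_ltn_trans (leq_subr _ _) nK).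
by rewrite (leq_trans (ltn_ord j) nK).
Qed.

Lemma fps_mul_eqr f g h n : (forall i, (i <= n)%N -> g i = h i) ->
  fps_mul f g n = fps_mul f h n.
Proof. by move=> gh; apply: eq_bigr => j _; rewrite gh // -ltnS. Qed.

Lemma fps_mulC f g : fps_mul f g = fps_mul g f.
Proof. by apply/funext => n; rewrite !(fps_mulE _ _ _ _ (ltnSn n)) mulrC. Qed.

Lemma fps_mulA f g h : fps_mul f (fps_mul g h) = fps_mul (fps_mul f g) h.
Proof.
suff E f' g' h' n : fps_mul f' (fps_mul g' h') n =
    (\poly_(i < n.+1) f' i
     * (\poly_(i < n.+1) g' i * \poly_(i < n.+1) h' i))`_n.
  apply/funext => n; rewrite (fps_mulC (fps_mul f g)) !E; congr (_`_n).
  by rewrite mulrA mulrC.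
rewrite coefMr; apply: eq_bigr => j _.
by rewrite coef_poly ltnS leq_subr -fps_mulE.
Qed.

Lemma fps_mul1 f : fps_mul f (fun n => (n == 0)%:R) = f.
Proof.
apply/funext => n; rewrite /fps_mul big_ord_recl /= subn0 mulr1.
by rewrite big1 ?addr0 // => j _; rewrite mulr0.
Qed.

Lemma fps_mul_jden0 (a b : A) h f : fps_mul (jden a b h) f 0 = f 0%N.
Proof. by rewrite /fps_mul big_ord_recl big_ord0 /= mul1r addr0. Qed.

Lemma fps_mul_jden1 (a b : A) h f :
  fps_mul (jden a b h) f 1 = f 1%N - a * f 0%N.
Proof.
by rewrite fps_mulC /fps_mul !big_ord_recl big_ord0 /= mulr1 addr0 mulrN mulrC.
Qed.

Lemma fps_mul_jdenSS (a b : A) h f n :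
  fps_mul (jden a b h) f n.+2 = f n.+2 - a * f n.+1 - b * fps_mul h f n.
Proof.
rewrite fps_mulC [in RHS]fps_mulC [in LHS]/fps_mul 2!big_ord_recl /= mulr1.
rewrite addrA; congr (_ + _); first by rewrite mulrN [a * _]mulrC.
by rewrite mulr_sumr -sumrN; apply: eq_bigr => j _; rewrite /= mulrN mulrCA.
Qed.

(* In terms of power series: f k = (1 - s_k z) f k.+1 - t_k z^2 f k.+2. *)
Definition jfrac_rec (s t : nat -> A) (f : nat -> fps A) := forall k,
  [/\ f k 0%N = f k.+1 0%N, f k 1%N = f k.+1 1%N - s k * f k.+1 0%N
    & forall n, f k n.+2 = f k.+1 n.+2 - s k * f k.+1 n.+1 - t k * f k.+2 n].

(** Each level gains two orders of z: if the tail truncation times [f 1] agrees with [f 2] below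
    order 2N, then the denominator times [f 1] agrees with [f 0] below order 2N + 2. *)
Lemma jfrac_trunc_mul N (s t : nat -> A) (f : nat -> fps A) n :
  jfrac_rec s t f -> (n < N.*2)%N ->
  fps_mul (jfrac_trunc s t N) (f 0%N) n = f 1%N n.
Proof.
elim: N s t f n => // N IHN s t f n fP nN /=.
set h := jfrac_trunc _ _ N; set D := jden _ _ _.
have -> : fps_mul (fps_inv D) (f 0%N) n =
          fps_mul (fps_inv D) (fps_mul D (f 1%N)) n.
  apply: fps_mul_eqr => i iN; have [f0 f1 f2] := fP 0%N.
  case: i iN => [|[|i]] iN.
  - by rewrite fps_mul_jden0.
  - by rewrite fps_mul_jden1.
  rewrite fps_mul_jdenSS f2; congr (_ - _ * _).
  by rewrite (IHN _ _ (fun k => f k.+1)) //; lia.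
rewrite fps_mulA (fps_mulC (fps_inv D) D) fps_mulV; last exact: unitr1.
by rewrite fps_mulC fps_mul1.
Qed.

Lemma jfrac_rec_has_jfrac (s t : nat -> A) (f : nat -> fps A) :
  jfrac_rec s t f -> (forall n, f 0%N n = (n == 0%N)%:R) ->
  has_jfrac (f 1%N) s t.
Proof.
move=> fP f0 n; exists n.+1 => N nN; rewrite -(jfrac_trunc_mul N _ _ _ _ fP).
  by rewrite (_ : f 0%N = fun n => (n == 0%N)%:R) ?fps_mul1 //; apply/funext.
by lia.
Qed.

End PowerSeries.
Arguments jfrac_rec {A}.

(* The coefficient of u^m in the r-th power of the Catalan series. *)
Fixpoint ballot r m : nat :=
  if m is m'.+1 then
    (fix row r := if r is r'.+1 then row r' + ballot r.+1 m' else 0)%N r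
  else 1.

Lemma ballotSS r m : ballot r.+1 m.+1 = (ballot r m.+1 + ballot r.+2 m)%N.
Proof. by []. Qed.

Lemma ballotr0 r : ballot r 0 = 1%N.
Proof. by []. Qed.

Lemma ballot0S m : ballot 0 m.+1 = 0%N.
Proof. by []. Qed.

Arguments ballot : simpl never.

(** The reflection formula, proved by Pascal's rule. The mirror image of 'C(2m + r, m - 1) is used
    so that m = 0 needs no subtraction. *)
Lemma ballot_bin r m :
  (ballot r.+1 m + 'C(m.*2 + r, m + r.+1) = 'C(m.*2 + r, m))%N.
Proof.
elim: m r => [|m IHm] r; first by rewrite bin0 bin_small.
elim: r => [|r IHr]; rewrite ballotSS.
  rewrite ballot0S; have := IHm 1%N.
  have sym : 'C(m.*2.+1, m.+1) = 'C(m.*2.+1, m).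
    by rewrite -[RHS]bin_sub; [congr 'C(_, _)|]; lia.
  rewrite doubleS addn0 !addn1 /= !addn2 => H.
  rewrite (binS m.*2.+1 m.+1) (binS m.*2.+1 m).
  by lia.
have := IHm r.+2; move: IHr.
rewrite doubleS !addSn !addnS !(binS (m.*2 + r).+2).
by lia.
Qed.

(** * Recurrences for binomial sums of ballot numbers *)

Section BallotSum.
Variable A : comNzRingType.
Implicit Types x y : A.

(** The coefficient of w^n in Cat(u)^r / (1 - y w)^(p + 1), where u = x w / (1 - y w). *)
Definition ballot_sum x y r n p : A :=
  \sum_(m < n.+1) x ^+ m * 'C(n + p, m + p)%:R * (ballot r m)%:R * y ^+ (n - m).

Lemma ballot_sum0 x y r p : ballot_sum x y r 0 p = 1.
Proof. by rewrite /ballot_sum big_ord1 binn !mulr1. Qed.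

(** This is Cat^(r+1) = Cat^r + u Cat^(r+2) divided by (1 - y w)^(p + 1). *)
Lemma ballot_sum_odd x y r n p :
  ballot_sum x y r.+1 n.+1 p =
  ballot_sum x y r n.+1 p + x * ballot_sum x y r.+2 n p.+1.
Proof.
rewrite /ballot_sum big_ord_recl [in RHS]big_ord_recl /= -addrA.
congr (_ + _); rewrite mulr_sumr -big_split; apply: eq_bigr => m _ /=.
by rewrite /bump /= ballotSS natrD !addSn !addnS subSS exprS; ring.
Qed.

Lemma ballot_sum_widen x y r n p : y * ballot_sum x y r n p =
  \sum_(m < n.+2) x ^+ m * 'C(n + p, m + p)%:R * (ballot r m)%:R
                  * y ^+ (n.+1 - m).
Proof.
rewrite big_ord_recr /= bin_small ?ltn_add2r // mulr0 !mul0r addr0 mulr_sumr.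
by apply: eq_bigr => m _; rewrite subSn -1?ltnS // exprS mulrCA.
Qed.

(** The same identity, its left side raised to p + 1 and multiplied by 1 - y w. *)
Lemma ballot_sum_even x y r n p :
  ballot_sum x y r.+1 n.+1 p.+1 =
  ballot_sum x y r n.+1 p + x * ballot_sum x y r.+2 n p.+1
  + y * ballot_sum x y r.+1 n p.+1.
Proof.
apply/eqP; rewrite -subr_eq; apply/eqP.
rewrite ballot_sum_widen /ballot_sum -sumrB.
rewrite big_ord_recl [in RHS]big_ord_recl /= -[RHS]addrA.
congr (_ + _); first by rewrite !ballotr0 !addnS !addSn !add0n binS natrD; ring.
rewrite mulr_sumr -big_split; apply: eq_bigr => m _ /=.
rewrite /bump /= ballotSS natrD !addSn !addnS subSS exprS.
by rewrite (binS _ (m + p).+1) natrD; ring.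
Qed.

(** The analogue for r = 0 and p = -1, where Cat^0 = 1 contributes nothing at w^(n + 1). *)
Lemma ballot_sum_even0 x y n :
  ballot_sum x y 1 n.+1 0 = x * ballot_sum x y 2 n 0 + y * ballot_sum x y 1 n 0.
Proof.
apply/eqP; rewrite -subr_eq; apply/eqP.
rewrite ballot_sum_widen /ballot_sum -sumrB big_ord_recl /= !bin0 subrr add0r.
rewrite mulr_sumr; apply: eq_bigr => m _ /=.
by rewrite /bump /= ballotSS ballot0S !addn0 add0n subSS binS natrD exprS; ring.
Qed.

End BallotSum.
Arguments ballot_sum {A}.

(** * The Jacobi fraction with alternating s_n and constant t_n *)

Section AlternatingJfrac.
Variable A : comUnitRingType.
Implicit Types s t : A.

(* In terms of power series, with w = z ^+ 2 and G r p the generating function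
   in w of n |-> ballot_sum t (s ^+ 2) r n p: the three cases are
   1, (1 + s z) G r p and G r p. *)
Definition ballot_fps s t k : fps A := fun n =>
  let G := ballot_sum t (s ^+ 2) k n./2 in
  if k is k'.+1 then
    if odd k then (if odd n then s else 1) * G k'./2
    else if odd n then 0 else G k'./2
  else (n == 0%N)%:R.

(** At odd levels the factor 1 + s z divides out, leaving [ballot_sum_odd]. At positive even levels
    it meets 1 - s z, and 1 - s^2 w gives [ballot_sum_even]; level 0 is [ballot_sum_even0]. *)
Lemma ballot_fps_rec s t :
  jfrac_rec (fun n => (-1) ^+ n * s) (fun=> t) (ballot_fps s t).
Proof.
move=> k; rewrite -signr_odd /ballot_fps; split => [||n] /=; rewrite ?negbK.
- case: k => [|k] /=; rewrite !ballot_sum0 ?mul1r //.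
  by case: odd; rewrite ?mul1r.
- case: k => [|k] /=; rewrite !ballot_sum0; first by ring.
  by case: odd => /=; ring.
case: k => [|k] /=.
  rewrite uphalf_half; case: odd => /=; last rewrite ballot_sum_even0; ring.
have := ballot_sum_odd _ t (s ^+ 2) k.+1 n./2 k./2.
have := ballot_sum_even _ t (s ^+ 2) k.+1 n./2 k./2.
rewrite !uphalf_half; case: (odd k); case: (odd n) => /= E2 E1.
- by ring.
- by rewrite E2; ring.
- by rewrite E1; ring.
- by rewrite E1; ring.
Qed.

End AlternatingJfrac.

(** * A binomial identity from two expansions of one polynomial *)

Section ConstantTerm.
Variable A : comNzRingType.
Implicit Types a b t : A.

Lemma coef_linear_exp a b n i :
  ((a%:P + b *: 'X) ^+ n)`_i = a ^+ (n - i) * b ^+ i * 'C(n, i)%:R.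
Proof.
rewrite exprDn (_ : \sum_(j < _) _ =
    \poly_(j < n.+1) (a ^+ (n - j) * b ^+ j * 'C(n, j)%:R)).
  by rewrite coef_poly ltnS; case: leqP => // ni; rewrite bin_small ?mulr0.
rewrite poly_def; apply: eq_bigr => j _.
by rewrite exprZn -rmorphXn mul_polyC scalerA mulr_natr scalerMnl.
Qed.

(* The Catalan number 'C(2k, k) - 'C(2k, k + 1) is a difference of coefficients
   of (1 + Y)^2k, and (1 + t)^2 Y - t (1 + Y)^2 = (1 - t Y) (Y - t). *)
Lemma ballot_sum1 t n : ballot_sum (- t) ((1 + t) ^+ 2) 1 n 0 =
  \sum_(j < n.+1) t ^+ j.*2 * ('C(n, j) * 'C(n, j))%:R
  + \sum_(j < n.+1) t ^+ j.*2.+1 * ('C(n, j) * 'C(n, j.+1))%:R.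
Proof.
pose Q : {poly A} :=
  ((1 + t) ^+ 2 *: 'X + (- t) *: (1%:P + 1 *: 'X) ^+ 2) ^+ n.
have QE : Q = (1%:P + (- t) *: 'X) ^+ n * ((- t)%:P + 1 *: 'X) ^+ n.
  rewrite /Q -exprMn; congr (_ ^+ n).
  by rewrite -!mul_polyC !(polyCN, polyCD, rmorphXn) /=; ring.
have coefQ d : Q`_(n + d) = \sum_(k < n.+1)
    (- t) ^+ k * 'C(n, k)%:R * 'C(k.*2, k + d)%:R * ((1 + t) ^+ 2) ^+ (n - k).
  rewrite /Q exprDn coef_sum; apply: eq_bigr => k _.
  rewrite !exprZn -(exprM _ 2 k) mul2n -scalerAl -scalerAr scalerA.
  rewrite coefMn coefZ coefXnM coef_linear_exp !expr1n.
  have -> : (n + d < n - k)%N = false by lia.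
  have -> : (n + d - (n - k) = k + d)%N by have := ltn_ord k; lia.
  by rewrite -mulr_natr; ring.
transitivity (Q`_n - Q`_n.+1).
  rewrite -[n in Q`_n]addn0 -[n.+1]addn1 !coefQ -sumrB; apply: eq_bigr => k _.
  by have := ballot_bin 0 k; rewrite !addn0 => <-; rewrite natrD; ring.
(* The first term of the second convolution contains the coefficient of Y^(n+1) in (Y - t)^n, which
   is 0. *)
rewrite QE !coefM [X in _ - X]big_ord_recl subn0 [X in _ * X + _]coef_linear_exp.
rewrite bin_small // !mulr0 add0r -sumrN; congr (_ + _); apply: eq_bigr => j _.
  rewrite !coef_linear_exp !expr1n bin_sub -1?ltnS // natrM -addnn exprD.
  have -> : (n - (n - j) = j)%N by have := ltn_ord j; lia.
  have -> : t ^+ j * t ^+ j = (- t) ^+ j * (- t) ^+ j.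
    by rewrite -!exprMn mulrNN.
  by ring.
rewrite !lift0 subSS !coef_linear_exp !expr1n bin_sub -1?ltnS // natrM.
have -> : (n - (n - j) = j)%N by have := ltn_ord j; lia.
have -> : t ^+ j.*2.+1 = - ((- t) ^+ j.+1 * (- t) ^+ j).
  by rewrite -exprD addSn addnn exprNn -signr_odd /= odd_double mulN1r opprK.
by ring.
Qed.

End ConstantTerm.

(** * Limits at q = -1 and the resulting closed forms *)

Section QMinusOne.
Import Order.TTheory Num.Theory numFieldNormedType.Exports.
Local Open Scope classical_set_scope.
Local Open Scope ring_scope.
Variable R : realType.
Implicit Types q : R.

Lemma qint_double q m : qint q m.*2 = (1 + q) * \sum_(j < m) q ^+ j.*2.
Proof.
elim: m => [|m IHm]; first by rewrite /qint !big_ord0 mulr0.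
by rewrite big_ord_recr mulrDr -IHm /qint doubleS !big_ord_recr /= exprS; ring.
Qed.

Lemma qint_eval n :
  exists2 P : {poly R}, P.[-1] = (if odd n then 1%N else n./2)%:R &
  forall q, qint q n = (1 + q) ^+ (~~ odd n) * P.[q].
Proof.
pose E : {poly R} := \sum_(j < n./2) 'X^(j.*2).
have EE q : E.[q] = \sum_(j < n./2) q ^+ j.*2.
  by rewrite horner_sum; apply: eq_bigr => j _; rewrite hornerXn.
case: (boolP (odd n)) => on.
  (* For odd n, [n] = [n - 1] + q^(n-1), and 1 + q divides [n - 1]. *)
  exists ((1 + 'X) * E + 'X^(n.-1)).
    rewrite !hornerE subrr mul0r add0r -signr_odd.
    by case: n on {E EE} => //= n /negPf ->.
  move=> q; rewrite !hornerE EE -qint_double.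
  have -> : n.-1 = n./2.*2 by lia.
  by rewrite -{1}[n]odd_double_half on [LHS]big_ord_recr.
exists E => [|q]; last by rewrite EE -qint_double even_halfK.
rewrite EE -[RHS]/(n./2%:R) -[n./2 in RHS]card_ord -sumr_const.
by apply: eq_bigr => j _; rewrite -signr_odd odd_double.
Qed.

Lemma qfact_eval n : exists2 P : {poly R}, P.[-1] = (n./2)`!%:R &
  forall q, qfact q n = (1 + q) ^+ n./2 * P.[q].
Proof.
elim: n => [|n [P P1 PE]].
  by exists 1 => [|q]; rewrite !hornerE // /qfact big_geq // mul1r.
have [Q Q1 QE] := qint_eval n.+1.
exists (P * Q) => [|q].
  rewrite hornerM P1 Q1 -natrM /= uphalf_half; case: odd => //=.
    by rewrite factS mulnC.
  by rewrite muln1.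
rewrite /qfact big_nat_recr //= -/(qfact q n) PE QE hornerM /= negbK.
by rewrite uphalf_half exprD; ring.
Qed.

Lemma bin_half_fact n k : (k < n)%N ->
  ((n./2)`! * (n.-1./2)`! = 'C(n./2, uphalf k) * 'C(n.-1./2, k./2) *
    ((k./2)`! * ((n - k)./2)`! * (k./2)`! * ((n.-1 - k)./2)`!
     * (if odd k.+1 then 1 else k.+1./2)))%N.
Proof.
move=> kn.
(* The value left by [k + 1] turns one floor(k/2)! into ceil(k/2)!. *)
have uE : ((uphalf k)`! = (k./2)`! * if odd k.+1 then 1 else k.+1./2)%N.
  rewrite /= uphalf_half; case: odd => //=; last by rewrite muln1.
  by rewrite factS mulnC.
have dE : (((n - k)./2)`! * ((n.-1 - k)./2)`! =
          (n./2 - uphalf k)`! * (n.-1./2 - k./2)`!)%N.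
  (* If k and n are both odd, the two factorials trade places. *)
  case: (boolP (odd k && odd n)) => h.
    by rewrite mulnC; congr (_`! * _`!)%N; lia.
  by congr (_`! * _`!)%N; lia.
have u_le : (uphalf k <= n./2)%N by lia.
have v_le : (k./2 <= n.-1./2)%N by lia.
rewrite -(bin_fact u_le) -(bin_fact v_le).
move: uE dE; set F := if _ then _ else _ => -> dE.
transitivity ('C(n./2, uphalf k) * 'C(n.-1./2, k./2) * ((k./2)`! * (k./2)`! * F)
  * ((n./2 - uphalf k)`! * (n.-1./2 - k./2)`!))%N; first by ring.
by rewrite -dE; ring.
Qed.

Lemma lim_coef_qNarayana n k : (k < n)%N ->
  lim ((qNarayana n q)`_k @[q --> (-1 : R)^']) =
  ('C(n./2, uphalf k) * 'C(n.-1./2, k./2))%:R.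
Proof.
move=> kn; have kn1 : (k <= n.-1)%N by lia.
have [A A1 AE] := qfact_eval n.
have [B B1 BE] := qfact_eval n.-1.
have [C C1 CE] := qfact_eval k.
have [D D1 DE] := qfact_eval (n - k).
have [E E1 EE] := qfact_eval (n.-1 - k).
have [F F1 FE] := qint_eval k.+1.
pose U := 'X^(k ^ 2 + k) * A * B; pose V := C * D * C * E * F.
have V1 : V.[-1] = ((k./2)`! * ((n - k)./2)`! * (k./2)`! * ((n.-1 - k)./2)`!
     * (if odd k.+1 then 1 else k.+1./2))%:R.
  by rewrite !hornerM C1 D1 E1 F1 !natrM.
have V0 : V.[-1] != 0.
  rewrite V1 pnatr_eq0 -lt0n !muln_gt0 !fact_gt0 /=.
  by case: (boolP (odd k)) => //=; lia.
have -> : ('C(n./2, uphalf k) * 'C(n.-1./2, k./2))%:R = U.[-1] / V.[-1].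
  apply: (canRL (mulfK V0)); rewrite V1 -natrM -bin_half_fact //.
  (* The exponent k^2 + k is even, so the power of -1 is 1. *)
  rewrite !hornerM hornerXn A1 B1 -signr_odd oddD oddX /=.
  by rewrite addbb mul1r natrM.
apply: cvg_lim; first exact: norm_hausdorff.
have : (fun q => U.[q] / V.[q]) @ (-1 : R)^' --> U.[-1] / V.[-1].
  apply: cvgM; last apply: cvgV => //.
    by apply: cvg_within_filter; exact: continuous_horner.
  by apply: cvg_within_filter; exact: continuous_horner.
apply: cvg_trans; apply: near_eq_cvg; near=> q.
have q1 : 1 + q != 0.
  by rewrite addrC addr_eq0; near: q; exact: nbhs_dnbhs_neq.
rewrite coef_poly kn /qbinom (ltnW kn) kn1 AE BE CE DE EE FE !hornerM hornerXn.
(* Numerator and denominator carry equally many factors 1 + q. *)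
have e : (n./2 + n.-1./2 = k./2 + (n - k)./2 + (k./2 + (n.-1 - k)./2)
                           + ~~ odd k.+1)%N by lia.
have e1 : (1 + q) ^+ n./2 * (1 + q) ^+ n.-1./2 /
    ((1 + q) ^+ k./2 * (1 + q) ^+ (n - k)./2
     * ((1 + q) ^+ k./2 * (1 + q) ^+ (n.-1 - k)./2)
     * (1 + q) ^+ (~~ odd k.+1)) = 1.
  by rewrite -!exprD -e divff // expf_neq0.
by rewrite -[LHS]mulr1 -[X in _ * X = _]e1 !invfM; ring.
Unshelve. all: by end_near.
Qed.

Lemma cpolyE n : cpoly R n =
  \poly_(k < n) ('C(n./2, uphalf k) * 'C(n.-1./2, k./2))%:R.
Proof.
apply/polyP => k; rewrite !coef_poly; case: ifP => // kn.
exact: lim_coef_qNarayana.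
Qed.

Lemma cpoly_odd n : cpoly R n.*2.+1 =
  \sum_(j < n.+1) 'X ^+ j.*2 * ('C(n, j) * 'C(n, j))%:R
  + \sum_(j < n.+1) 'X ^+ j.*2.+1 * ('C(n, j) * 'C(n, j.+1))%:R.
Proof.
have sumE (F : nat -> {poly R}) m : \sum_(k < m.*2.+1) F k =
    \sum_(j < m.+1) F j.*2 + \sum_(j < m) F j.*2.+1.
  elim: m => [|m IHm]; first by rewrite big_ord0 !big_ord1 addr0.
  rewrite doubleS 2!big_ord_recr /= IHm [in RHS]big_ord_recr /=.
  by rewrite [in X in _ = _ + X]big_ord_recr doubleS /=; ring.
rewrite cpolyE poly_def (sumE (fun k =>
  ('C(n.*2.+1./2, uphalf k) * 'C(n.*2.+1.-1./2, k./2))%:R *: 'X^k)).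
congr (_ + _).
  apply: eq_bigr => j _.
  by rewrite /= !uphalf_double !half_double scaler_nat mulr_natr.
(* The odd sum has a vanishing top term, as 'C(n, n + 1) = 0. *)
rewrite [RHS]big_ord_recr /= (@bin_small n n.+1) // muln0 mulr0 addr0.
apply: eq_bigr => j _; rewrite scaler_nat mulr_natr /= !uphalf_double.
by rewrite !half_double mulnC.
Qed.

Lemma cpoly_even n : cpoly R n.*2.+2 = (1 + 'X) * cpoly R n.*2.+1.
Proof.
rewrite !cpolyE; apply/polyP => k.
rewrite mulrDl mul1r coefD coefXM !coef_poly /=.
case: k => [|k] /=; first by rewrite !bin0 addr0.
rewrite uphalf_double doubleK !ltnS ltn_neqAle.
case: leqP => [kn|]; last by rewrite andbF addr0.
rewrite andbT binS mulnDl natrD [('C(n, uphalf k) * _)%N]mulnC; congr (_ + _).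
(* At k = 2n, the index k + 1 is beyond c_(2n+1), and 'C(n, n + 1) = 0. *)
by case: eqP => //= ->; rewrite doubleK bin_small.
Qed.

(** Combines 'C(2k, k) - 'C(2k, k + 1) with (k + 1) 'C(2k, k + 1) = k 'C(2k, k). *)
Lemma catalan_ballot k : catalan R k = (ballot 1 k)%:R.
Proof.
have := ballot_bin 0 k; have := mul_bin_left (k.*2) k.
rewrite !addn0 addn1 => H1 H2.
apply: (canLR (mulfK _)); first by rewrite pnatr_eq0.
by rewrite -natrM; congr (_%:R); nia.
Qed.

End QMinusOne.

Lemma cpoly_odd_ballot (R : realType) n :
  cpoly R n.*2.+1 = ballot_sum (- 'X) ((1 + 'X) ^+ 2) 1 n 0.
Proof. by rewrite cpoly_odd ballot_sum1. Qed.

Lemma ballot_sum_catalan (R : realType) n :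
  ballot_sum (- 'X) ((1 + 'X) ^+ 2) 1 n 0 =
  \sum_(k < n.+1) (- 'X) ^+ k * 'C(n, k)%:R * (catalan R k)%:P
                  * (1 + 'X) ^+ (n.*2 - k.*2).
Proof.
apply: eq_bigr => k _; rewrite !addn0 catalan_ballot rmorph_nat -exprM.
by rewrite mul2n doubleB.
Qed.

Theorem theorem1 (R : realType) :
  [/\ has_jfrac (fun n => cpoly R n.+1)
        (fun n => (-1) ^+ n * (1 + 'X)) (fun _ => - 'X),
      forall n : nat, cpoly R n.*2.+1 =
        \sum_(k < n.+1) (- 'X) ^+ k * 'C(n, k)%:R * (catalan R k)%:P
                        * (1 + 'X) ^+ (n.*2 - k.*2)
    & forall n : nat, cpoly R n.*2.+2 =
        \sum_(k < n.+1) (- 'X) ^+ k * 'C(n, k)%:R * (catalan R k)%:P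
                        * (1 + 'X) ^+ (n.*2 - k.*2 + 1)].
Proof.
split=> [|n|n].
- rewrite (_ : (fun n => _) = ballot_fps _ (1 + 'X) (- 'X) 1%N).
    exact: jfrac_rec_has_jfrac (ballot_fps_rec _ _ _) _.
  (* The factor 1 + (1 + t) z of level 1 encodes c_(2m+2) = (1 + t) c_(2m+1). *)
  apply/funext => n; rewrite /ballot_fps /= -[in LHS](odd_double_half n).
  case: odd; rewrite ?add1n ?cpoly_even cpoly_odd_ballot //.
  by rewrite mul1r.
- by rewrite cpoly_odd_ballot ballot_sum_catalan.
rewrite cpoly_even cpoly_odd_ballot ballot_sum_catalan mulr_sumr.
by apply: eq_bigr => k _; rewrite addn1 exprS mulrCA.
Qed.
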